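(* Let $\mathfrak{n}>\mathfrak{m}\ge2$ be integers, let $\Sigma\subseteq\Delta_{\mathfrak{m},\mathfrak{n}}^{\mathbb{N}}$ be a coded subshift with generating set $\mathcal{C}$, and suppose $h=h(\Sigma)$ and $h_\pi=h(\pi\Sigma)$, where $$h:=\limsup_{n\to\infty}\frac1n\log\#\mathcal{G}_n,\qquad h_\pi:=\limsup_{n\to\infty}\frac1n\log\#\pi\mathcal{G}_n.$$ Then the box dimension of $\Pi(\Sigma)$ exists and $$\dim_{\mathrm{B}}\Pi(\Sigma)=\frac{h(\pi\Sigma)}{\log\mathfrak{m}}+\frac{h(\Sigma)-h(\pi\Sigma)}{\log\mathfrak{n}}.$$
   Context: Let $\mathfrak{n}>\mathfrak{m}\ge2$ be integers and $\Delta_{\mathfrak{m},\mathfrak{n}}=\{(a,b): 1\le a\le\mathfrak{m},\ 1\le b\le\mathfrak{n},\ a,b\in\mathbb{N}\}$. For $(a,b)\in\Delta_{\mathfrak{m},\mathfrak{n}}$ let $S_{(a,b)}:[0,1]^2\to[0,1]^2$, $S_{(a,b)}(x,y)=\left(\frac{x+a-1}{\mathfrak{m}},\frac{y+b-1}{\mathfrak{n}}\right)$. The coding map $\Pi:\Delta_{\mathfrak{m},\mathfrak{n}}^{\mathbb{N}}\to[0,1]^2$ is $\Pi((a_1,b_1)(a_2,b_2)\ldots)=\lim_{n\to\infty}S_{(a_1,b_1)}\circ\cdots\circ S_{(a_n,b_n)}(0)$. A subshift is a compact set $\Sigma$ of sequences over a finite alphabet (here a digit set $\mathcal{I}\subseteq\Delta_{\mathfrak{m},\mathfrak{n}}$)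 with $\sigma(\Sigma)\subseteq\Sigma$, where $\sigma$ is the left shift. $\Sigma^*$ denotes the language of $\Sigma$ (finite words appearing in sequences of $\Sigma$), $\Sigma_n$ the words of length $n$ in $\Sigma^*$, and the topological entropy is $h(\Sigma)=\lim_{n\to\infty}\frac1n\log\#\Sigma_n$. The projection $\pi$ maps a finite or infinite word $(a_1,b_1)(a_2,b_2)\ldots$ to $a_1a_2\ldots$; $\pi\Sigma$ is again a subshift. For bounded $E$, $N_\delta(E)$ is the smallest number of sets of diameter $\delta$ needed to cover $E$; $\underline{\dim}_{\mathrm{B}}E$ and $\overline{\dim}_{\mathrm{B}}E$ are the lower and upper limits as $\delta\to0$ of $\log N_\delta(E)/(-\log\delta)$, and $\dim_{\mathrm{B}}E$ is their common value when they coincide. Coded subshifts: let $\mathcal{C}$ be a countable family of finite words over $\mathcal{I}$ (the generators), and let $B=\{s\,c_{1}c_{2}\ldots : c_{j}\in\mathcal{C},\ s\text{ is a suffix of a word in }\mathcal{C}\}$. The coded subshift generated by $\mathcal{C}$ is $\Sigma=\overline{B}$. Then $\pi\Sigma$ is the coded subshift generated by $\pi\mathcal{C}=\{\pi(c):c\in\mathcal{C}\}$. $\mathcal{G}_n$ is the set of words of length $n$ in $\Sigma^*$ which can be written as a concatenation of generators from $\mathcal{C}$; $\pi\mathcal{G}_n$ is the set of words of length $n$ in $(\pi\Sigma)^*$ which can be written as a concatenation of generators from $\pi\mathcal{C}$. *)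

(* Defs.v *)
From HB Require Import structures.
From mathcomp Require Import all_boot all_order all_algebra.
From mathcomp Require Import all_classical all_reals all_analysis.
Import Order.TTheory GRing.Theory Num.Theory.
Import numFieldNormedType.Exports.

Set Implicit Arguments.
Unset Strict Implicit.
Unset Printing Implicit Defensive.

Local Open Scope classical_set_scope.
Local Open Scope ring_scope.

(* The join of the pointed and topological structures on products is not
   declared in the library; `lim` in R * R needs it. *)
HB.instance Definition _ (U V : ptopologicalType) := Pointed.on (U * V)%type.

(* The map S_(a,b), with digits counted from 0: the pair (a, b) in
   'I_m * 'I_n stands for the digit (a + 1, b + 1) of Delta_{m,n}. *)
Definition digit_map (R : realType) (m n : nat) (d : 'I_m * 'I_n)
    (p : R * R) : R * R :=
  ((p.1 + d.1%:R) / m%:R, (p.2 + d.2%:R) / n%:R).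

Definition coding_map (R : realType) (m n : nat) (x : nat -> 'I_m * 'I_n) :
    R * R :=
  lim ((fun k : nat => foldr (@digit_map R m n) (0, 0) (mkseq x k)) @ \oo).

(* x = s c_0 c_1 c_2 ...  The second clause makes the concatenation infinite
   even if some of the words c_j are empty. *)
Definition is_concatenation (T : Type) (s : seq T) (c : nat -> seq T)
    (x : nat -> T) : Prop :=
  (forall k, s ++ flatten (mkseq c k)
             = mkseq x (size (s ++ flatten (mkseq c k)))) /\
  (forall i : nat, exists k, (i <= size (flatten (mkseq c k)))%N).

Definition coded_base (T : finType) (C : set (seq T)) : set (nat -> T) :=
  [set x | exists s : seq T, (exists2 w, C w & suffix s w) /\
           exists c : nat -> seq T, (forall j, C (c j)) /\
           is_concatenation s c x].

Definition coded_subshift (T : finType) (C : set (seq T)) : set (nat -> T) :=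
  closure (coded_base C : set {ptws nat -> discrete_topology T}).

Definition language (T : Type) (Sigma : set (nat -> T)) : set (seq T) :=
  [set w | exists2 x, Sigma x &
           exists k, w = mkseq (fun i => x (k + i)%N) (size w)].

Definition words (T : finType) (Sigma : set (nat -> T)) (k : nat) :
    {set k.-tuple T} :=
  [set w : k.-tuple T | `[< language Sigma (tval w) >]]%SET.

Definition generated_words (T : finType) (Sigma : set (nat -> T))
    (C : set (seq T)) (k : nat) : {set k.-tuple T} :=
  [set w in words Sigma k |
    `[< exists cs : seq (seq T),
          (forall c, c \in cs -> C c) /\ tval w = flatten cs >]]%SET.

Definition proj_seq (A B : Type) (x : nat -> A * B) : nat -> A :=
  fun k => (x k).1.

Definition proj_shift (A B : Type) (Sigma : set (nat -> A * B)) :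
    set (nat -> A) :=
  [set proj_seq x | x in Sigma].

Definition proj_words (A B : Type) (C : set (seq (A * B))) : set (seq A) :=
  [set map fst c | c in C].

(* Extended reals are used so that log 0 = -oo. *)
Definition log_rate (R : realType) (u : nat -> nat) (k : nat) : \bar R :=
  (lne (u k)%:R%:E / k%:R%:E)%E.

Definition entropy (R : realType) (T : finType) (Sigma : set (nat -> T)) :
    \bar R :=
  lim (log_rate R (fun k => #|words Sigma k|) @ \oo).

(* The norm of R * R in the library is the max norm. *)
Definition euclidean_dist (R : realType) (p q : R * R) : R :=
  Num.sqrt ((p.1 - q.1) ^+ 2 + (p.2 - q.2) ^+ 2).

Definition diameter (R : realType) (U : set (R * R)) : \bar R :=
  ereal_sup [set (euclidean_dist p q)%:E | p in U & q in U].

Definition covering_number (R : realType) (delta : R) (E : set (R * R)) :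
    \bar R :=
  ereal_inf [set k%:R%:E | k in
    [set k : nat | exists U : 'I_k -> set (R * R),
       (forall i, diameter (U i) = delta%:E) /\
       E `<=` \bigcup_(i in [set: 'I_k]) U i]].

Definition box_ratio (R : realType) (E : set (R * R)) (delta : R) : \bar R :=
  (lne (covering_number delta E) / (- ln delta)%:E)%E.

Definition lower_box_dim (R : realType) (E : set (R * R)) : \bar R :=
  limf_einf (box_ratio E) 0^'+.

Definition upper_box_dim (R : realType) (E : set (R * R)) : \bar R :=
  limf_esup (box_ratio E) 0^'+.

Definition has_box_dim (R : realType) (E : set (R * R)) (v : \bar R) : Prop :=
  lower_box_dim E = v /\ upper_box_dim E = v.

(* Main.v *)
Require Import Defs.
From mathcomp Require Import all_boot all_order all_algebra.
From mathcomp Require Import all_classical all_reals all_analysis.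
From mathcomp Require Import lra ring zify.
Import Order.TTheory GRing.Theory Num.Theory.
Import numFieldNormedType.Exports.
Set Implicit Arguments.
Unset Strict Implicit.
Unset Printing Implicit Defensive.
Local Open Scope classical_set_scope.
Local Open Scope ring_scope.

(** Write E for the image of Sigma under the coding map, a_k and b_k for the
numbers of words of length k of Sigma and of its projection.  A prefix of p
pairs followed by q further first coordinates determines a rectangle of size
m^-(p+q) by n^-p that contains all points whose codes start that way; when
m^-(p+q) and n^-p are both comparable to delta, these are the approximate
squares of side delta, and the covering number of E at scale delta is, up to a
bounded factor, the number of approximate squares that E meets.

Upper bound ([covering_number_le_words]).  An approximate square that E meets
is given by a word of length p of Sigma and a word of length q of the
projection, so at most a_p * b_q sets are needed.

Lower bound ([le_covering_number_generated]).  An arbitrary pair of such words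
need not come from one point of Sigma, but two concatenations of generators can
always be joined: if w is a concatenation of generators and v is the projection
of one, then w followed by a lift of v begins a sequence of Sigma.  So all pairs
made of a generated word of length p and a projected generated word of length
q give distinct approximate squares, and a set of diameter delta meets at most
nine of these.

It remains to compare growth rates.  The numbers of words are submultiplicative,
so both entropies are limits and log a_k <= (h + eps) k + K for all k
([subadditive_growth]).  The hypotheses give a lower bound on the number of
generated words only along some lengths N; concatenating words of one such
length extends it to all lengths, up to a bounded loss
([supermultiplicative_growth]).  With p = log(1/delta) / log n and
p + q = log(1/delta) / log m, up to bounded errors, both bounds give
log(1/delta) * (h_pi / log m + (h - h_pi) / log n), up to
eps * log(1/delta) + O(1) ([has_box_dim_of_growth]).

If Sigma is empty, then both entropies and both box dimensions are -oo. *)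

(** * Digit expansions and the coding map *)

(** The first digit is the most significant one, so that a prefix of a code
corresponds to a cell of the grid of its level. *)
Fixpoint digits_value (b : nat) (s : seq 'I_b) : nat :=
  if s is d :: s' then (d * b ^ size s' + digits_value s')%N else 0%N.

Lemma digits_value_lt (b : nat) (s : seq 'I_b) : (digits_value s < b ^ size s)%N.
Proof.
elim: s => [|d s IH] //=; rewrite expnS.
have lt_db := ltn_ord d.
apply: (@leq_trans (d.+1 * b ^ size s)%N); last by rewrite leq_mul2r lt_db orbT.
by rewrite mulSn addnC ltn_add2r.
Qed.

Lemma digits_value_inj (b : nat) (s t : seq 'I_b) :
  size s = size t -> digits_value s = digits_value t -> s = t.
Proof.
elim: s t => [|d s IH] [|e t] //= [eq_st] eq_val.
have b_gt0 : (0 < b ^ size s)%N by apply: leq_ltn_trans (digits_value_lt s).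
have eq_de : d = e.
  apply/val_inj; have := congr1 (divn^~ (b ^ size s)%N) eq_val.
  rewrite [in X in _ = X -> _]eq_st !divnMDl -?eq_st //.
  by rewrite !divn_small ?addn0 ?digits_value_lt // eq_st digits_value_lt.
rewrite eq_de; congr cons; apply: IH => //.
by apply/eqP; rewrite -(eqn_add2l (d * b ^ size s)) eq_val eq_st eq_de.
Qed.

Definition fraction_value (R : realType) (b : nat) (s : seq 'I_b) : R :=
  (digits_value s)%:R / (b ^ size s)%:R.

Lemma fraction_value_cat (R : realType) (b : nat) (s t : seq 'I_b) :
  (0 < b)%N ->
  fraction_value R (s ++ t)
  = fraction_value R s + fraction_value R t / (b ^ size s)%:R.
Proof.
move=> b_gt0; rewrite /fraction_value size_cat.
have -> : digits_value (s ++ t) = (digits_value s * b ^ size t + digits_value t)%N.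
  elim: s => [|d s IH] //=; rewrite IH size_cat expnD.
  by rewrite mulnDl addnA mulnA.
have nz k : (b ^ k)%:R != 0 :> R by rewrite pnatr_eq0 -lt0n expn_gt0 b_gt0.
have := nz (size s); have := nz (size t).
rewrite natrD expnD !natrM => *; field.
by apply/andP.
Qed.

Lemma fraction_value_ge0 (R : realType) (b : nat) (s : seq 'I_b) :
  0 <= fraction_value R s.
Proof. by rewrite divr_ge0. Qed.

Lemma fraction_value_le1 (R : realType) (b : nat) (s : seq 'I_b) :
  fraction_value R s <= 1.
Proof.
rewrite /fraction_value ler_pdivrMr ?ltr0n ?mul1r ?ler_nat ?(ltnW (digits_value_lt s)) //.
exact: leq_ltn_trans (digits_value_lt s).
Qed.

Lemma digit_map_foldr (R : realType) (m n : nat) (s : seq ('I_m * 'I_n)) :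
  (0 < m)%N -> (0 < n)%N ->
  foldr (@digit_map R m n) (0, 0) s
  = (fraction_value R (map fst s), fraction_value R (map snd s)).
Proof.
move=> m_gt0 n_gt0; elim: s => [|[d e] s IH] /=; first by rewrite /fraction_value !mul0r.
rewrite IH /digit_map /fraction_value /= !size_map.
have nzm k : (m ^ k)%:R != 0 :> R by rewrite pnatr_eq0 -lt0n expn_gt0 m_gt0.
have nzn k : (n ^ k)%:R != 0 :> R by rewrite pnatr_eq0 -lt0n expn_gt0 n_gt0.
have := nzm 1%N; have := nzm (size s); have := nzn 1%N; have := nzn (size s).
rewrite !expnS !expn0 !muln1 !natrD !natrM => *.
by congr pair; field; apply/andP.
Qed.

Definition expansion (R : realType) (b : nat) (x : nat -> 'I_b) : R :=
  lim ((fun k => fraction_value R (mkseq x k)) @ \oo).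

Lemma mkseqD (T : Type) (x : nat -> T) (k j : nat) :
  mkseq x (k + j) = mkseq x k ++ mkseq (fun i => x (k + i)%N) j.
Proof.
rewrite /mkseq iotaD map_cat add0n; congr cat.
rewrite -[in LHS](addn0 k) iotaDl -map_comp; exact: eq_map.
Qed.

Lemma fraction_value_prefix (R : realType) (b : nat) (x : nat -> 'I_b) (k j : nat) :
  (0 < b)%N ->
  fraction_value R (mkseq x k) <= fraction_value R (mkseq x (k + j)) /\
  fraction_value R (mkseq x (k + j)) <= fraction_value R (mkseq x k) + (b ^ k)%:R^-1.
Proof.
move=> b_gt0; rewrite mkseqD fraction_value_cat // size_mkseq.
set t := mkseq _ j; have ibk : 0 <= (b ^ k)%:R^-1 :> R by rewrite invr_ge0.
split; first by rewrite lerDl mulr_ge0 ?fraction_value_ge0.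
by rewrite lerD2l ler_piMl ?fraction_value_le1.
Qed.

Lemma expansion_cvg (R : realType) (b : nat) (x : nat -> 'I_b) : (0 < b)%N ->
  (fun k => fraction_value R (mkseq x k)) @ \oo --> expansion R x.
Proof.
move=> b_gt0; apply: nondecreasing_is_cvgn.
  move=> i j le_ij; rewrite -(subnKC le_ij).
  exact: (fraction_value_prefix R x _ _ b_gt0).1.
by exists 1 => _ [k _ <-]; exact: fraction_value_le1.
Qed.

(** A point lies in the closed grid cell of each prefix of its expansion: the
digits from position k on contribute at most b^-k. *)
Lemma expansion_bounds (R : realType) (b : nat) (x : nat -> 'I_b) (k : nat) :
  (0 < b)%N ->
  fraction_value R (mkseq x k) <= expansion R x <=
    fraction_value R (mkseq x k) + (b ^ k)%:R^-1.
Proof.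
move=> b_gt0; have cv := @expansion_cvg R b x b_gt0.
have ev (j : nat) : (k <= j)%N -> exists i, j = (k + i)%N.
  by move=> le_kj; exists (j - k)%N; rewrite subnKC.
apply/andP; split.
  apply: (limr_ge (cvgP _ cv)); near=> j.
  have [|i ->] := ev j; first by near: j; exact: nbhs_infty_ge.
  exact: (fraction_value_prefix R x _ _ b_gt0).1.
apply: (limr_le (cvgP _ cv)); near=> j.
have [|i ->] := ev j; first by near: j; exact: nbhs_infty_ge.
exact: (fraction_value_prefix R x _ _ b_gt0).2.
Unshelve. all: by end_near.
Qed.

Lemma coding_mapE (R : realType) (m n : nat) (x : nat -> 'I_m * 'I_n) :
  (0 < m)%N -> (0 < n)%N ->
  coding_map R x = (expansion R (proj_seq x), expansion R (fun k => (x k).2)).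
Proof.
move=> m_gt0 n_gt0; rewrite /coding_map.
under eq_fun do rewrite digit_map_foldr // -!map_comp.
apply: cvg_lim.
  by apply: (@norm_hausdorff R (R * R)%type).
exact: (cvg_pair (expansion_cvg (x := proj_seq x) m_gt0)
                 (expansion_cvg (x := fun k => (x k).2) n_gt0)).
Qed.

(** * Diameters and covers *)

(** The sides are in the ratio 3 : 4 so that the diagonal, hence the diameter,
is exactly delta; covers are made of sets whose diameter equals delta. *)
Definition box (R : realType) (delta : R) (p : R * R) : set (R * R) :=
  [set q | p.1 <= q.1 <= p.1 + 3 / 5 * delta /\
           p.2 <= q.2 <= p.2 + 4 / 5 * delta].

Lemma diameter_box (R : realType) (delta : R) (p : R * R) :
  0 <= delta -> diameter (box delta p) = delta%:E.
Proof.
move=> d_ge0; apply/eqP; rewrite eq_le; apply/andP; split.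
  apply: ge_ereal_sup => _ [q [/andP[? ?] /andP[? ?]]] [r [/andP[? ?] /andP[? ?]]] <-.
  rewrite lee_fin /euclidean_dist -[leRHS]ger0_norm // -sqrtr_sqr ler_wsqrtr //.
  have -> : delta ^+ 2 = (3 / 5 * delta) ^+ 2 + (4 / 5 * delta) ^+ 2 by field.
  by rewrite lerD // -ler_sqrt ?sqr_ge0 // !sqrtr_sqr [leRHS]ger0_norm ?mulr_ge0 //
    ler_norml; lra.
apply: ereal_sup_ubound.
exists (p.1 + 3 / 5 * delta, p.2 + 4 / 5 * delta); first by split=> /=; lra.
exists p; first by split; lra.
rewrite /euclidean_dist /= -[in RHS](ger0_norm d_ge0) -sqrtr_sqr.
by congr (Num.sqrt _)%:E; field.
Qed.

Lemma coord_dist_le_diameter (R : realType) (delta : R) (U : set (R * R)) (p q : R * R) :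
  diameter U = delta%:E -> U p -> U q ->
  `|p.1 - q.1| <= delta /\ `|p.2 - q.2| <= delta.
Proof.
move=> dU Up Uq.
have le_dist : euclidean_dist p q <= delta.
  by rewrite -lee_fin -dU; apply: ereal_sup_ubound; exists p => //; exists q.
by split; apply: le_trans le_dist; rewrite -sqrtr_sqr ler_wsqrtr // ?lerDl ?lerDr sqr_ge0.
Qed.

Lemma covering_number_le (R : realType) (delta : R) (E : set (R * R))
    (T : finType) (A : {set T}) (U : T -> set (R * R)) :
  (forall t, t \in A -> diameter (U t) = delta%:E) ->
  E `<=` [set p | exists2 t, t \in A & U t p] ->
  (covering_number delta E <= #|A|%:R%:E)%E.
Proof.
move=> dU cover; apply: ereal_inf_lbound; exists #|A| => //.
exists (fun i => U (enum_val i)); split=> [i|p /cover[t At Utp]].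
  by apply: dU; exact: enum_valP.
by exists (enum_rank_in At t); rewrite //= enum_rankK_in.
Qed.

(** The cells have width 1 / M >= delta, so points at distance at most delta lie
in cells whose indices differ by at most 2; residues modulo 3 tell these
apart. *)
Lemma grid_index_eq (R : realType) (delta u v : R) (M a b : nat) :
  M%:R * delta <= 1 -> `|u - v| <= delta ->
  a%:R <= M%:R * u <= a%:R + 1 -> b%:R <= M%:R * v <= b%:R + 1 ->
  a = b %[mod 3] -> a = b.
Proof.
move=> Md; rewrite ler_norml => /andP[uv1 uv2] /andP[a1 a2] /andP[b1 b2].
have M_ge0 : 0 <= M%:R :> R by [].
have h1 : M%:R * (u - v) <= M%:R * delta by exact: ler_wpM2l.
have h2 : M%:R * - delta <= M%:R * (u - v) by exact: ler_wpM2l.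
have le_ab : (a <= b + 2)%N by rewrite -(ler_nat R) natrD; nra.
have le_ba : (b <= a + 2)%N by rewrite -(ler_nat R) natrD; nra.
clear - le_ab le_ba; lia.
Qed.

(** A set of diameter delta meets at most nine cells of a grid whose two mesh
sizes are at least delta: a cell is determined by the set of the cover that
contains its marked point and by its two indices modulo 3. *)
Lemma card_le_cover (R : realType) (delta : R) (T : finType) (W : {set T})
    (P : T -> R * R) (M N : nat) (A B : T -> nat) (k : nat) (U : 'I_k -> set (R * R)) :
  M%:R * delta <= 1 -> N%:R * delta <= 1 ->
  (forall t, t \in W -> (A t)%:R <= M%:R * (P t).1 <= (A t)%:R + 1) ->
  (forall t, t \in W -> (B t)%:R <= N%:R * (P t).2 <= (B t)%:R + 1) ->
  {in W &, injective (fun t => (A t, B t))} ->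
  (forall i, diameter (U i) = delta%:E) ->
  (forall t, t \in W -> exists i, U i (P t)) ->
  (#|W| <= k * 9)%N.
Proof.
move=> Md Nd hA hB injAB dU cover.
have [->|[t0 Wt0]] := set_0Vmem W; first by rewrite cards0.
have [i0 _] := cover t0 Wt0.
pose f t := odflt i0 [pick i | `[<U i (P t)>]].
have Uf t : t \in W -> U (f t) (P t).
  move=> Wt; rewrite /f; case: pickP => [i /asboolP //|none].
  by have [i /asboolP] := cover t Wt; rewrite none.
pose phi t : 'I_k * ('I_3 * 'I_3) := (f t, (inord (A t %% 3), inord (B t %% 3))).
have injphi : {in W &, injective phi}.
  move=> s t Ws Wt [] eq_f /(congr1 (@nat_of_ord 3)) eqA /(congr1 (@nat_of_ord 3)) eqB.
  move: eqA eqB; rewrite !inordK ?ltn_mod // => eqA eqB.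
  have Us := Uf s Ws; have Ut := Uf t Wt; rewrite -eq_f in Ut.
  have [d1 d2] := coord_dist_le_diameter (dU _) Us Ut.
  apply: injAB => //; congr pair.
    exact: grid_index_eq Md d1 (hA s Ws) (hA t Wt) eqA.
  exact: grid_index_eq Nd d2 (hB s Ws) (hB t Wt) eqB.
rewrite -(card_in_imset injphi); apply: leq_trans (max_card _) _.
by rewrite !card_prod !card_ord.
Qed.

(** * Words and concatenations of generators *)

Lemma mkseq_language (T : finType) (Sigma : set (nat -> T)) (x : nat -> T) (j k : nat) :
  Sigma x -> language Sigma (mkseq (fun i => x (j + i)%N) k).
Proof. by move=> Sx; exists x => //; exists j; rewrite size_mkseq. Qed.

Lemma in_words (T : finType) (Sigma : set (nat -> T)) (k : nat) (w : k.-tuple T) :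
  w \in words Sigma k <-> language Sigma w.
Proof. by rewrite inE; split=> [/asboolP|/asboolP]. Qed.

Lemma words_gt0 (T : finType) (Sigma : set (nat -> T)) (k : nat) :
  Sigma !=set0 -> (0 < #|words Sigma k|)%N.
Proof.
move=> [x Sx]; apply/card_gt0P.
exists (Tuple (introT eqP (size_mkseq (fun i => x (0 + i)%N) k))).
exact/in_words/mkseq_language.
Qed.

(** A word of length k + l splits into two words of the language. *)
Lemma card_words_add (T : finType) (Sigma : set (nat -> T)) (k l : nat) :
  (#|words Sigma (k + l)| <= #|words Sigma k| * #|words Sigma l|)%N.
Proof.
rewrite -cardsX.
pose cat2 (u : k.-tuple T * l.-tuple T) := cat_tuple u.1 u.2.
apply: leq_trans (leq_imset_card cat2 _); apply/subset_leq_card/fintype.subsetP => w.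
move=> /in_words[x Sx [j]]; rewrite size_tuple mkseqD => eq_w; apply/imsetP.
pose u := Tuple (introT eqP (size_mkseq (fun i => x (j + i)%N) k)).
pose v := Tuple (introT eqP (size_mkseq (fun i => x ((j + k) + i)%N) l)).
exists (u, v).
  by rewrite inE; apply/andP; split; apply/in_words; exact: mkseq_language.
apply: val_inj; rewrite /= eq_w; congr cat.
by apply: eq_mkseq => i; rewrite addnA.
Qed.

Definition generated (T : finType) (C : set (seq T)) : set (seq T) :=
  [set w | exists cs : seq (seq T), (forall c, c \in cs -> C c) /\ w = flatten cs].

Lemma generated_nil (T : finType) (C : set (seq T)) : generated C [::].
Proof. by exists [::]. Qed.

Lemma generated_cat (T : finType) (C : set (seq T)) (u v : seq T) :
  generated C u -> generated C v -> generated C (u ++ v).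
Proof.
move=> [cs [Ccs ->]] [ds [Cds ->]]; exists (cs ++ ds); rewrite flatten_cat.
by split=> // c; rewrite mem_cat => /orP[/Ccs|/Cds].
Qed.

(** A projected generated word is lifted generator by generator; the lift has
the same length and is again a concatenation of generators. *)
Lemma generated_proj (A B : finType) (C : set (seq (A * B))) (v : seq A) :
  generated (proj_words C) v -> exists2 w, generated C w & v = map fst w.
Proof.
move=> [cs [Ccs ->]]; elim: cs Ccs => [|c cs IH] Ccs.
  by exists [::] => //; exists [::].
have Ccs' d : d \in cs -> proj_words C d.
  by move=> d_cs; apply: Ccs; rewrite inE d_cs orbT.
have [w genw eq_w] := IH Ccs'.
have [d Cd dc] : proj_words C c by apply: Ccs; exact: mem_head.
exists (d ++ w); last by rewrite map_cat dc -eq_w.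
apply: generated_cat => //; exists [:: d]; rewrite /= cats0.
by split=> // e; rewrite inE => /eqP ->.
Qed.

Lemma in_generated_words (T : finType) (Sigma : set (nat -> T)) (C : set (seq T))
    (k : nat) (w : k.-tuple T) :
  w \in generated_words Sigma C k <-> language Sigma w /\ generated C w.
Proof.
rewrite inE -in_words; split=> [/andP[-> /asboolP] //|[-> ?]].
exact/asboolP.
Qed.

(** Concatenation maps pairs of generated words injectively to generated words;
the hypothesis puts the results back in the language. *)
Lemma card_generated_words_add (T : finType) (Sigma : set (nat -> T))
    (C : set (seq T)) (k l : nat) :
  generated C `<=` language Sigma ->
  (#|generated_words Sigma C k| * #|generated_words Sigma C l|
   <= #|generated_words Sigma C (k + l)|)%N.
Proof.
move=> genL; rewrite -cardsX.
pose cat2 (u : k.-tuple T * l.-tuple T) := cat_tuple u.1 u.2.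
have inj2 : injective cat2.
  move=> [u v] [u' v'] /(congr1 val)/eqP /=; rewrite eqseq_cat ?size_tuple //.
  by move=> /andP[/eqP/val_inj -> /eqP/val_inj ->].
rewrite -(card_imset _ inj2); apply/subset_leq_card/fintype.subsetP => z /imsetP[[u v]].
rewrite inE => /andP[/in_generated_words[_ gu] /in_generated_words[_ gv]] ->.
have guv := generated_cat gu gv.
by apply/in_generated_words; split=> //; exact: genL.
Qed.

Lemma generated_words0 (T : finType) (Sigma : set (nat -> T)) (C : set (seq T)) :
  generated C `<=` language Sigma -> (0 < #|generated_words Sigma C 0|)%N.
Proof.
move=> genL; apply/card_gt0P; exists [tuple]; apply/in_generated_words.
by split; [exact/genL/generated_nil|exact: generated_nil].
Qed.

(** The finite concatenations are prefixes of one another, so letter i can be read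
off any of them that is long enough. *)
Lemma concatenation_exists (T : Type) (c : nat -> seq T) :
  (forall i, exists k, (i <= size (flatten (mkseq c k)))%N) ->
  exists x, is_concatenation [::] c x.
Proof.
move=> unb.
have nthE d k i j : (i < size (flatten (mkseq c k)))%N ->
    nth d (flatten (mkseq c (k + j))) i = nth d (flatten (mkseq c k)) i.
  by move=> lt_i; rewrite mkseqD flatten_cat nth_cat lt_i.
have [k0 size_k0] := unb 1%N.
have [d _] : exists d : T, True.
  by case: (flatten _) size_k0 => [|d ?] //; exists d.
have [K Kgt] := choice (fun i => unb i.+1).
exists (fun i => nth d (flatten (mkseq c (K i))) i); split=> // k /=.
apply: (@eq_from_nth _ d); first by rewrite size_mkseq.
move=> i lt_i; rewrite nth_mkseq //.
by rewrite -(nthE _ _ _ (K i)) // addnC nthE.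
Qed.

(** After the generators that make up w, repeat the nonempty generator c0 for
ever. *)
Lemma coded_base_extends (T : finType) (C : set (seq T)) (c0 w : seq T) :
  C c0 -> (0 < size c0)%N -> generated C w ->
  exists2 x, coded_base C x & mkseq x (size w) = w.
Proof.
move=> Cc0 c0_gt0 [cs [Ccs ->]].
pose c := nth c0 cs.
have mkseq_c : mkseq c (size cs) = cs by exact: mkseq_nth.
have [i|x xP] := @concatenation_exists T c.
  exists (size cs + i)%N; rewrite mkseqD flatten_cat size_cat.
  apply: leq_trans (leq_addl _ _).
  have -> : mkseq (fun j => c (size cs + j)%N) i = nseq i c0.
    apply: (@eq_from_nth _ c0) => [|j]; rewrite ?size_mkseq ?size_nseq // => lt_ji.
    by rewrite nth_mkseq // nth_nseq lt_ji /c nth_default // leq_addr.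
  by elim: i => //= i IH; rewrite size_cat -add1n leq_add.
exists x; last by have := xP.1 (size cs); rewrite mkseq_c /= => <-.
exists [::]; split; first by exists c0 => //; exact: suffix0s.
exists c; split=> // j; rewrite /c.
have [lt_j|ge_j] := ltnP j (size cs); first by apply/Ccs/mem_nth.
by rewrite nth_default.
Qed.

Lemma coded_base_generator (T : finType) (C : set (seq T)) (x : nat -> T) :
  coded_base C x -> exists2 c, C c & (0 < size c)%N.
Proof.
move=> [s [_ [c [Cc [_ /(_ 1%N)[k]]]]]].
elim: k => [|k IH] //; rewrite -(addn1 k) mkseqD flatten_cat size_cat /= cats0 addn0.
have [->|] := posnP (size (c k)); first by rewrite addn0.
by exists (c k).
Qed.

(** * Growth rates, upper and lower limits *)

(** Fekete's lemma: h is the infimum of u k / k, and Euclidean division of k by a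
length N that nearly attains the infimum gives the upper bound.  The linear
form, with K independent of k, lets the bound be used at several lengths
at once, including lengths that stay bounded. *)
Lemma subadditive_growth (R : realType) (u : nat -> R) :
  (forall k, 0 <= u k) -> (forall k l, u (k + l)%N <= u k + u l) ->
  exists h : R, (forall k, h * k%:R <= u k) /\
    forall eps, 0 < eps -> exists K, forall k, u k <= (h + eps) * k%:R + K.
Proof.
move=> u_ge0 u_add.
pose S := [set u k / k%:R | k in [set k | (0 < k)%N]].
have S_lb : has_lbound S by exists 0 => _ [k _ <-]; rewrite divr_ge0.
have infS : has_inf S by split=> //; exists (u 1%N / 1%:R), 1%N.
have u_mul q k : u (q * k)%N <= u 0%N + q%:R * u k.
  elim: q => [|q IH]; first by rewrite mul0n mul0r addr0.
  by rewrite mulSn; apply: le_trans (u_add _ _) _; rewrite -natr1 mulrDl; lra.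
exists (inf S); split=> [k|eps eps_gt0].
  have [->|k_gt0] := posnP k; first by rewrite mulr0.
  by rewrite -ler_pdivlMr ?ltr0n //; apply: ge_inf => //; exists k.
have [_ [N /= N_gt0 <-] ltN] := inf_adherent eps_gt0 infS.
(* With k = q N + r, the block part gives u 0 + q u N and the rest u 0 + r u 1. *)
exists (2 * u 0%N + N%:R * u 1%N) => k.
have N_gt0' : 0 < N%:R :> R by rewrite ltr0n.
rewrite {1}(divn_eq k N).
have h1 := u_add (k %/ N * N)%N (k %% N)%N; have h2 := u_mul (k %/ N)%N N.
have h3 : u (k %% N)%N <= u 0%N + N%:R * u 1%N.
  rewrite -[X in u X]muln1; apply: le_trans (u_mul _ _) _.
  by rewrite lerD2l ler_wpM2r // ler_nat ltnW // ltn_mod.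
have h4 : (k %/ N)%:R * u N <= (inf S + eps) * k%:R.
  rewrite ltr_pdivrMr // in ltN.
  have hk : (k %/ N)%:R * N%:R <= k%:R :> R by rewrite -natrM ler_nat leq_divM.
  have S_ge0 : 0 <= inf S.
    by apply: lb_le_inf; [exact: infS.1|move=> _ [j _ <-]; rewrite divr_ge0].
  apply: (@le_trans _ _ ((inf S + eps) * ((k %/ N)%:R * N%:R))).
    by rewrite mulrCA; apply: ler_wpM2l => //; apply: ltW.
  by apply: ler_wpM2l => //; lra.
lra.
Qed.

Lemma log_rateE (R : realType) (u : nat -> nat) (k : nat) :
  (0 < k)%N -> (0 < u k)%N -> log_rate R u k = (ln (u k)%:R / k%:R)%:E.
Proof.
move=> k_gt0 u_gt0; rewrite /log_rate lne_EFin ?ltr0n //.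
by rewrite inver pnatr_eq0 -[_ == 0%N]negbK -lt0n k_gt0.
Qed.

Lemma log_rate_cvg (R : realType) (u : nat -> nat) (h : R) :
  (forall k, (0 < u k)%N) -> (forall k, h * k%:R <= ln (u k)%:R) ->
  (forall eps, 0 < eps -> exists K, forall k, ln (u k)%:R <= (h + eps) * k%:R + K) ->
  log_rate R u @ \oo --> h%:E.
Proof.
move=> u_gt0 u_ge u_le.
have cv : (fun k => ln (u k)%:R / k%:R) @ \oo --> h.
  apply/cvgrPdist_le => eps eps_gt0.
  have [|K hK] := u_le (eps / 2); first by rewrite divr_gt0.
  near=> k.
  have k_gt0 : 0 < k%:R :> R by rewrite ltr0n; near: k; exists 1%N.
  have K_le : K <= (eps / 2) * k%:R.
    rewrite mulrC -ler_pdivrMr ?divr_gt0 //; near: k; exact: nbhs_infty_ger.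
  rewrite distrC ger0_norm ?subr_ge0 ?ler_pdivlMr //.
  rewrite lerBlDl ler_pdivrMr //.
  by apply: le_trans (hK k) _; lra.
have rateE : \forall k \near \oo, log_rate R u k = (ln (u k)%:R / k%:R)%:E.
  by exists 1%N => // k k_gt0; rewrite log_rateE.
apply: cvg_EFin; first by apply: filterS rateE => k ->.
apply: cvg_trans cv; apply: near_eq_cvg.
by apply: filterS rateE => k /= ->.
Unshelve. all: by end_near.
Qed.

Lemma limn_esup_frequently (R : realType) (f : nat -> \bar R) (h eps : R) :
  limn_esup f = h%:E -> 0 < eps ->
  exists2 N, (0 < N)%N & ((h - eps)%:E < f N)%E.
Proof.
move=> fh eps_gt0; apply: contrapT => none.
have : (limn_esup f <= (h - eps)%:E)%E.
  apply: ge_ereal_inf; exists (ereal_sup (f @` [set k | (0 < k)%N])).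
    by exists [set k | (0 < k)%N] => //; exists 1%N.
  apply: ge_ereal_sup => _ [k /= k_gt0 <-]; rewrite leNgt; apply/negP => lt_k.
  by apply: none; exists k.
by rewrite fh lee_fin; lra.
Qed.

(** The upper limit provides a single length N at which g is large.  Powers of the
words of length N give the multiples of N, and every k is within N of a
multiple p <= k.  It is enough to reach a smaller length p: when p letters are
used in place of k, the words obtained are still told apart by k letters. *)
Lemma supermultiplicative_growth (R : realType) (g : nat -> nat) (h eps : R) :
  (0 < g 0)%N -> (forall k l, g k * g l <= g (k + l))%N ->
  limn_esup (log_rate R g) = h%:E -> 0 < eps ->
  exists K, forall k, exists2 p, (p <= k)%N &
    (0 < g p)%N /\ (h - eps) * k%:R - K <= ln (g p)%:R.
Proof.
move=> g0 g_add gh eps_gt0.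
have [N N_gt0 ltN] := limn_esup_frequently gh eps_gt0.
have gN_gt0 : (0 < g N)%N.
  rewrite lt0n; apply: contraTneq ltN => gN.
  rewrite /log_rate gN le0_lneNy // inver pnatr_eq0 gtn_eqF // mulNyr.
  by rewrite gtr0_sg ?invr_gt0 ?ltr0n // mul1e.
move: ltN; rewrite log_rateE // lte_fin ltr_pdivlMr ?ltr0n // => ltN.
have g_pow j : (g N ^ j <= g (j * N))%N.
  elim: j => [|j IH]; first by rewrite mul0n.
  by rewrite expnS mulSn; apply: leq_trans (g_add _ _); rewrite leq_mul2l IH orbT.
have lng_ge0 : 0 <= ln (g N)%:R :> R by rewrite ln_ge0 // ler1n.
(* Dropping the incomplete last block loses at most one factor g N. *)
exists (ln (g N)%:R) => k; exists (k %/ N * N)%N; first exact: leq_divM.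
have gp_gt0 : (0 < g (k %/ N * N))%N.
  by apply: leq_trans (g_pow _); rewrite expn_gt0 gN_gt0.
split=> //.
have h1 : (k %/ N)%:R * ln (g N)%:R <= ln (g (k %/ N * N)%N)%:R :> R.
  rewrite mulr_natl -lnXn ?ltr0n // ler_ln ?posrE ?exprn_gt0 ?ltr0n //.
  by rewrite -natrX ler_nat.
have h2 : k%:R <= ((k %/ N)%:R + 1) * N%:R :> R.
  by rewrite natr1 -natrM ler_nat ltnW // ltn_ceil.
apply: le_trans h1.
have [neg|pos] := leP (h - eps) 0.
  have := ler_wpM2l (ler0n R (k %/ N)) lng_ge0; rewrite mulr0.
  have : (h - eps) * k%:R <= 0 by rewrite mulr_le0_ge0.
  lra.
have h3 : (h - eps) * k%:R <= (h - eps) * (((k %/ N)%:R + 1) * N%:R).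
  by apply: ler_wpM2l => //; exact: ltW.
have h4 : ((k %/ N)%:R + 1) * ((h - eps) * N%:R) <= ((k %/ N)%:R + 1) * ln (g N)%:R.
  by apply: ler_wpM2l; [rewrite natr1|exact: ltW].
lra.
Qed.

Lemma limf_esup_eq (R : realType) (T : choiceType) (X : filteredType T)
    (F : set_system X) (f : X -> \bar R) (v : R) :
  ProperFilter F ->
  (forall eps, 0 < eps -> \forall x \near F, ((v - eps)%:E <= f x <= (v + eps)%:E)%E) ->
  limf_esup f F = v%:E.
Proof.
move=> FF near_v; apply/eqP; rewrite eq_le; apply/andP; split.
  apply/lee_addgt0Pr => eps eps_gt0.
  apply: ge_ereal_inf; eexists.
    exists [set x | ((v - eps)%:E <= f x <= (v + eps)%:E)%E]; last by [].
    exact: near_v.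
  by apply: ge_ereal_sup => _ [x /= /andP[_ ?] <-].
apply: le_ereal_inf_tmp => _ [V FV <-]; apply/lee_subgt0Pr => eps eps_gt0.
have [x [Vx /andP[vx _]]] := filter_ex (filterI FV (near_v _ eps_gt0)).
by apply: le_trans vx _; apply: ereal_sup_ubound; exists x.
Qed.

Lemma limf_einf_eq (R : realType) (T : choiceType) (X : filteredType T)
    (F : set_system X) (f : X -> \bar R) (v : R) :
  ProperFilter F ->
  (forall eps, 0 < eps -> \forall x \near F, ((v - eps)%:E <= f x <= (v + eps)%:E)%E) ->
  limf_einf f F = v%:E.
Proof.
move=> FF near_v; rewrite /limf_einf (@limf_esup_eq _ _ _ _ _ (- v)) ?EFinN ?oppeK //.
move=> eps eps_gt0; apply: filterS (near_v _ eps_gt0) => x /andP[h1 h2].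
by rewrite leeNr -EFinN leeNl -EFinN; apply/andP; split; [move: h2|move: h1];
  congr (_ <= _)%E; congr EFin; lra.
Qed.

(** * Covers of the coded set *)

(** The number of words is submultiplicative, hence the limit that defines the
entropy exists. *)
Lemma entropy_growth (R : realType) (T : finType) (Sigma : set (nat -> T)) :
  Sigma !=set0 ->
  exists2 h : R, entropy R Sigma = h%:E &
    forall eps, 0 < eps -> exists K, forall k,
      ln (#|words Sigma k|%:R : R) <= (h + eps) * k%:R + K.
Proof.
move=> Sigma0; have w_gt0 k := words_gt0 k Sigma0.
have [|k l|h [h_le h_ge]] := @subadditive_growth R (fun k => ln #|words Sigma k|%:R).
- by move=> k; rewrite ln_ge0 // ler1n.
- rewrite -lnM ?posrE ?ltr0n // ler_ln ?posrE ?mulr_gt0 ?ltr0n //.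
  by rewrite -natrM ler_nat card_words_add.
exists h => //; apply: cvg_lim => //.
exact: log_rate_cvg.
Qed.

Lemma mkseq_proj (A B : Type) (x : nat -> A * B) (k : nat) :
  mkseq (proj_seq x) k = map fst (mkseq x k).
Proof. by rewrite /mkseq -map_comp. Qed.

Lemma mkseq_snd (A B : Type) (x : nat -> A * B) (k : nat) :
  mkseq (fun i => (x i).2) k = map snd (mkseq x k).
Proof. by rewrite /mkseq -map_comp. Qed.

(** The first p pairs of a code and the q first coordinates that follow place its
point in a rectangle of sides at most delta / 2, which fits in a box of
diameter delta. *)
Lemma covering_number_le_words (R : realType) (m n : nat)
    (Sigma : set (nat -> 'I_m * 'I_n)) (delta : R) (p q : nat) :
  (0 < m)%N -> (0 < n)%N -> 0 < delta ->
  (n ^ p)%:R^-1 <= delta / 2 -> (m ^ (p + q))%:R^-1 <= delta / 2 ->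
  (covering_number delta (@coding_map R m n @` Sigma)
     <= (#|words Sigma p| * #|words (proj_shift Sigma) q|)%:R%:E)%E.
Proof.
move=> m_gt0 n_gt0 d_gt0 small_n small_m; rewrite -cardsX.
pose U (t : p.-tuple ('I_m * 'I_n) * q.-tuple 'I_m) :=
  box delta (fraction_value R (map fst t.1 ++ t.2), fraction_value R (map snd t.1)).
apply: (covering_number_le (U := U)); first by move=> t _; apply/diameter_box/ltW.
move=> _ [x Sx <-].
pose u := Tuple (introT eqP (size_mkseq (fun i => x (0 + i)%N) p)).
pose v := Tuple (introT eqP (size_mkseq (fun i => proj_seq x (p + i)%N) q)).
exists (u, v).
  rewrite inE; apply/andP; split; apply/in_words; apply: mkseq_language => //.
  by exists x.
rewrite coding_mapE // /U /box /=.
have := @expansion_bounds R m (proj_seq x) (p + q) m_gt0.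
have := @expansion_bounds R n (fun i => (x i).2) p n_gt0.
rewrite mkseqD mkseq_proj mkseq_snd => /andP[h1 h2] /andP[h3 h4].
split; lra.
Qed.

(** A concatenation of p letters and the lift of a projected concatenation of q
letters can be joined and extended to a sequence of Sigma.  The points obtained
lie in pairwise different cells of a grid whose meshes m^-(p+q) and n^-p are
at least delta. *)
Lemma le_covering_number_generated (R : realType) (m n : nat)
    (C : set (seq ('I_m * 'I_n))) (c0 : seq ('I_m * 'I_n))
    (Sigma : set (nat -> 'I_m * 'I_n)) (delta : R) (p q : nat) :
  (0 < m)%N -> (0 < n)%N -> C c0 -> (0 < size c0)%N -> coded_base C `<=` Sigma ->
  (n ^ p)%:R * delta <= 1 -> (m ^ (p + q))%:R * delta <= 1 ->
  (((#|generated_words Sigma C p|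
      * #|generated_words (proj_shift Sigma) (proj_words C) q|)%:R / 9)%:E
    <= covering_number delta (@coding_map R m n @` Sigma))%E.
Proof.
move=> m_gt0 n_gt0 Cc0 c0_gt0 baseS small_n small_m.
apply: le_ereal_inf_tmp => _ [k [U [dU cover]] <-].
rewrite lee_fin ler_pdivrMr // -natrM ler_nat -cardsX.
set W := finset.setX _ _.
have [x0 _ _] := coded_base_extends Cc0 c0_gt0 (generated_nil C).
pose lifts (t : p.-tuple ('I_m * 'I_n) * q.-tuple 'I_m) (x : nat -> 'I_m * 'I_n) :=
  t \in W -> [/\ Sigma x, mkseq x p = t.1 &
    mkseq (proj_seq x) (p + q) = map fst t.1 ++ t.2].
have [t|f fP] := @choice _ _ lifts.
  case: t => u v.
  have [|nW] := boolP ((u, v) \in W); last first.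
    by exists x0 => Wuv; rewrite Wuv in nW.
  rewrite inE => /andP[/in_generated_words[_ gu] /in_generated_words[_]].
  move=> /generated_proj[v' gv' eq_v].
  have [x bx] := coded_base_extends Cc0 c0_gt0 (generated_cat gu gv').
  have sv' : size v' = q by rewrite -(size_map fst) -eq_v size_tuple.
  rewrite size_cat size_tuple sv' => eq_x; exists x => _; split; first exact: baseS.
    have := congr1 (take p) eq_x; rewrite take_size_cat ?size_tuple //.
    by rewrite mkseqD take_size_cat ?size_mkseq.
  by rewrite mkseq_proj eq_x map_cat -eq_v.
pose A (t : p.-tuple ('I_m * 'I_n) * q.-tuple 'I_m) := digits_value (map fst t.1 ++ t.2).
pose B (t : p.-tuple ('I_m * 'I_n) * q.-tuple 'I_m) := digits_value (map snd t.1).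
have cell (b j : nat) (x : nat -> 'I_b) : (0 < b)%N ->
    (digits_value (mkseq x j))%:R <= (b ^ j)%:R * expansion R x
      <= (digits_value (mkseq x j))%:R + 1.
  move=> b_gt0; have := @expansion_bounds R b x j b_gt0.
  have bj_gt0 : 0 < (b ^ j)%:R :> R by rewrite ltr0n expn_gt0 b_gt0.
  rewrite /fraction_value size_mkseq -[X in _ + X]mul1r -mulrDl.
  by rewrite ler_pdivrMr // ler_pdivlMr // ![_ * expansion _ _]mulrC.
apply: (@card_le_cover R delta _ W (fun t => coding_map R (f t))
          (m ^ (p + q)) (n ^ p) A B k U) => //.
- move=> t /fP[_ _ eq_t]; rewrite coding_mapE //= /A -eq_t; exact: cell.
- move=> t /fP[_ eq_t _]; rewrite coding_mapE //= /B -eq_t -mkseq_snd; exact: cell.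
- move=> [u v] [u' v'] _ _ [eqA eqB].
  have := digits_value_inj _ eqA; rewrite /= !size_cat !size_map !size_tuple.
  move=> /(_ erefl)/eqP; rewrite eqseq_cat ?size_map ?size_tuple //.
  move=> /andP[/eqP eq1 /eqP/val_inj ->].
  have := digits_value_inj _ eqB; rewrite /= !size_map !size_tuple => /(_ erefl) eq2.
  congr pair; apply: val_inj; rewrite /= -(zip_unzip u) -(zip_unzip u').
  by rewrite /unzip1 /unzip2 eq1 eq2.
- move=> t /fP[St _ _]; have [i _ Ui] := cover _ (imageP (@coding_map R m n) St).
  by exists i.
Qed.

(** The level k is the last one whose cells have size at least delta, and each
further level divides the size by at least 2. *)
Lemma scale_bounds (R : realType) (b : nat) (delta : R) :
  (2 <= b)%N -> 0 < delta < 1 ->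
  let k := Num.truncn (- ln delta / ln b%:R) in
  (b ^ k)%:R * delta <= 1 /\ (b ^ (k + 2))%:R^-1 <= delta / 2.
Proof.
move=> b_ge2 /andP[d_gt0 d_lt1] k.
have lnb_gt0 : 0 < ln b%:R :> R by rewrite ln_gt0 // ltr1n.
have lnd : 0 < - ln delta by rewrite oppr_gt0 ln_lt0 // d_gt0 d_lt1.
have bpow_gt0 j : 0 < (b ^ j)%:R :> R by rewrite ltr0n expn_gt0 (leq_trans _ b_ge2).
have lnpow j : ln ((b ^ j)%:R * delta) = j%:R * ln b%:R + ln delta.
  rewrite lnM ?posrE // natrX lnXn ?mulr_natl //.
  by rewrite ltr0n (leq_trans _ b_ge2).
have /andP[] : k%:R <= - ln delta / ln b%:R < k.+1%:R.
  by apply: truncn_itv; rewrite divr_ge0 // ltW.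
rewrite ler_pdivlMr // ltr_pdivrMr // => k_le k_gt.
split.
  by rewrite -ler_ln ?posrE ?mulr_gt0 // ln1 lnpow; lra.
have : 1 <= (b ^ k.+1)%:R * delta.
  by rewrite -ler_ln ?posrE ?mulr_gt0 // ln1 lnpow; lra.
move=> ge1; rewrite addn2 (expnS b k.+1) natrM.
have b2 : 2 <= b%:R :> R by rewrite ler_nat.
have ge2 : 2 * 1 <= b%:R * ((b ^ k.+1)%:R * delta) by rewrite ler_pM.
rewrite -[leLHS]mul1r ler_pdivrMr; last by rewrite mulr_gt0 // (lt_le_trans _ b2).
by rewrite mulrAC ler_pdivlMr // mul1r [leRHS]mulrC -mulrA -[leLHS]mulr1.
Qed.

Lemma mul_truncn_near (R : realType) (c x : R) : 0 <= x ->
  `|c * (Num.truncn x)%:R - c * x| <= `|c|.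
Proof.
move=> /truncn_itv /andP[]; rewrite -natr1 -mulrBr normrM => h1 h2.
by rewrite ler_piMr // ler_norml; lra.
Qed.

(** * Box dimension *)

Lemma box_ratio_bounds (R : realType) (E : set (R * R)) (delta lo hi : R) :
  0 < delta < 1 -> 0 < lo ->
  (lo%:E <= covering_number delta E <= hi%:E)%E ->
  ((ln lo / - ln delta)%:E <= box_ratio E delta <= (ln hi / - ln delta)%:E)%E.
Proof.
move=> /[dup] d01 /andP[d_gt0 d_lt1] lo_gt0.
have L_gt0 : 0 < - ln delta by rewrite oppr_gt0 ln_lt0.
rewrite /box_ratio; case: (covering_number delta E) => [r| |] //; last first.
  by rewrite andbC leye_eq.
rewrite !lee_fin => /andP[lo_r r_hi]; have r_gt0 := lt_le_trans lo_gt0 lo_r.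
rewrite lne_EFin // inver gt_eqF // -EFinM !lee_fin !ler_pM2r ?invr_gt0 //.
by rewrite !ler_ln ?posrE ?lo_r ?r_hi // (lt_le_trans r_gt0).
Qed.

Lemma entropy_set0 (R : realType) (T : finType) :
  entropy R (set0 : set (nat -> T)) = -oo%E.
Proof.
apply: cvg_lim => //; apply: cvg_near_cst; exists 1%N => // k k_gt0.
rewrite /log_rate (_ : words _ _ = finset.set0) ?cards0.
  rewrite le0_lneNy // inver pnatr_eq0 gtn_eqF // mulNyr gtr0_sg ?mul1e //.
  by rewrite invr_gt0 ltr0n.
by apply/setP => w; rewrite !inE; apply/asboolP => -[].
Qed.

(** The empty family covers the empty set, so the covering number is 0, whose
logarithm is -oo. *)
Lemma has_box_dim_set0 (R : realType) : has_box_dim (set0 : set (R * R)) -oo%E.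
Proof.
have ratioNy : \forall d \near 0^'+, box_ratio (set0 : set (R * R)) d = -oo%E.
  near=> d.
  have d_gt0 : 0 < d by near: d; exact: nbhs_right_gt.
  have d_lt1 : d < 1 by near: d; exact: nbhs_right_lt.
  have L_gt0 : 0 < - ln d by rewrite oppr_gt0 ln_lt0 // d_gt0.
  rewrite /box_ratio le0_lneNy; last first.
    have := @covering_number_le R d set0 bool finset.set0 (fun=> set0).
    by rewrite cards0; apply=> // t; rewrite inE.
  by rewrite inver gt_eqF // mulNyr gtr0_sg ?invr_gt0 // mul1e.
split.
  apply/eqP; rewrite /lower_box_dim /limf_einf eqe_oppLR /= -leye_eq.
  apply: le_ereal_inf_tmp => _ [V FV <-].
  have [d [Vd ratio_d]] := filter_ex (filterI FV ratioNy).
  by apply: ereal_sup_ubound; exists d; rewrite //= ratio_d.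
apply/eqP; rewrite -leeNy_eq; apply: ge_ereal_inf; eexists.
  by exists [set d | box_ratio (set0 : set (R * R)) d = -oo%E]; [exact: ratioNy|].
by apply: ge_ereal_sup => _ [d /= -> <-].
Unshelve. all: by end_near.
Qed.

Lemma neg_ln_ge_near0 (R : realType) (M : R) : \forall d \near 0^'+, 0 < d < 1 /\ M <= - ln d.
Proof.
near=> d.
have d_gt0 : 0 < d by near: d; exact: nbhs_right_gt.
split; first by rewrite d_gt0; near: d; exact: nbhs_right_lt.
rewrite lerNr -[leRHS]expRK ler_ln ?posrE ?expR_gt0 //.
by near: d; apply: nbhs_right_le; exact: expR_gt0.
Unshelve. all: by end_near.
Qed.

(** Here a and b stand for the numbers of words of the shift and of its projection,
g and gp for the numbers of generated words.  Let L = - ln delta, k and l the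
integer parts of L / ln n and L / ln m.  The upper bound is used with p = k + 2
and q = l - k, the lower bound with p <= k and q <= l - k; in both cases
h k + hp (l - k) = hp l + (h - hp) k differs from v L by a bounded amount. *)
Lemma has_box_dim_of_growth (R : realType) (m n : nat) (E : set (R * R))
    (h hp : R) (a b g gp : nat -> nat) :
  (2 <= m)%N -> (m < n)%N ->
  (forall eps, 0 < eps -> exists K, forall k, ln (a k)%:R <= (h + eps) * k%:R + K) ->
  (forall eps, 0 < eps -> exists K, forall k, ln (b k)%:R <= (hp + eps) * k%:R + K) ->
  (forall k, (0 < a k)%N) -> (forall k, (0 < b k)%N) ->
  (forall eps, 0 < eps -> exists K, forall k, exists2 p, (p <= k)%N &
    (0 < g p)%N /\ (h - eps) * k%:R - K <= ln (g p)%:R) ->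
  (forall eps, 0 < eps -> exists K, forall k, exists2 p, (p <= k)%N &
    (0 < gp p)%N /\ (hp - eps) * k%:R - K <= ln (gp p)%:R) ->
  (forall delta p q, 0 < delta ->
    (n ^ p)%:R^-1 <= delta / 2 -> (m ^ (p + q))%:R^-1 <= delta / 2 ->
    (covering_number delta E <= (a p * b q)%:R%:E)%E) ->
  (forall delta p q, 0 < delta ->
    (n ^ p)%:R * delta <= 1 -> (m ^ (p + q))%:R * delta <= 1 ->
    (((g p * gp q)%:R / 9)%:E <= covering_number delta E)%E) ->
  has_box_dim E (hp / ln m%:R + (h - hp) / ln n%:R)%:E.
Proof.
move=> m_ge2 lt_mn a_le b_le a_gt0 b_gt0 g_ge gp_ge cov_le cov_ge.
have n_ge2 : (2 <= n)%N by apply: leq_trans m_ge2 (ltnW lt_mn).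
have lm_gt0 : 0 < ln m%:R :> R by rewrite ln_gt0 // ltr1n.
have lnn_gt0 : 0 < ln n%:R :> R by rewrite ln_gt0 // ltr1n.
have lm_le : ln m%:R <= ln n%:R :> R.
  by rewrite ler_ln ?posrE ?ltr0n ?ler_nat ?(ltnW lt_mn) //
    (leq_trans _ m_ge2, leq_trans _ n_ge2).
set v := hp / _ + _.
suff near_v eps : 0 < eps -> \forall d \near 0^'+,
    ((v - eps)%:E <= box_ratio E d <= (v + eps)%:E)%E.
  by split; [apply: limf_einf_eq|apply: limf_esup_eq].
(* The error in both growth rates is chosen so that e * (L / ln m) = eps / 2 * L;
   the other eps / 2 * L absorbs the constants c1 and c2 once L is large. *)
move=> eps_gt0; pose e := eps / 2 * ln m%:R.
have e_gt0 : 0 < e by rewrite mulr_gt0 // divr_gt0.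
have [K1 aK] := a_le e e_gt0; have [K2 bK] := b_le e e_gt0.
have [K3 gK] := g_ge e e_gt0; have [K4 gpK] := gp_ge e e_gt0.
pose c1 := `|h - hp| + `|hp + e| + 2 * (h + e) + K1 + K2.
pose c2 := `|h - hp| + `|hp - e| + K3 + K4 + ln 9.
have := neg_ln_ge_near0 (Num.max (2 * c1 / eps) (2 * c2 / eps)); apply: filterS => d.
rewrite ge_max !ler_pdivrMr // => -[d01 /andP[c1L c2L]]; set L := - ln d in c1L c2L.
have /andP[d_gt0 d_lt1] := d01.
have L_gt0 : 0 < L by rewrite oppr_gt0 ln_lt0 // d01.
have [nk1 nk2] := scale_bounds n_ge2 d01; have [ml1 ml2] := scale_bounds m_ge2 d01.
rewrite -/L in nk1 nk2 ml1 ml2.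
have Ln_ge0 : 0 <= L / ln n%:R by rewrite divr_ge0 // ltW.
have Lm_ge0 : 0 <= L / ln m%:R by rewrite divr_ge0 // ltW.
have le_kl : (Num.truncn (L / ln n%:R) <= Num.truncn (L / ln m%:R))%N.
  by apply: le_truncn; rewrite ler_pM2l // lef_pV2 ?posrE.
have near_k := mul_truncn_near (h - hp) Ln_ge0.
have near_l1 := mul_truncn_near (hp + e) Lm_ge0.
have near_l2 := mul_truncn_near (hp - e) Lm_ge0.
set k := Num.truncn (L / ln n%:R) in nk1 nk2 le_kl near_k.
set l := Num.truncn (L / ln m%:R) in ml1 ml2 le_kl near_l1 near_l2.
have [p le_pk [gp_gt0 gp_le]] := gK k.
have [q le_ql [gq_gt0 gq_le]] := gpK (l - k)%N.
have lkE : (l - k)%:R = l%:R - k%:R :> R by rewrite natrB.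
have pow_le (x i j : nat) : (2 <= x)%N -> (i <= j)%N ->
    (x ^ j)%:R * d <= 1 -> (x ^ i)%:R * d <= 1.
  move=> x_ge2 le_ij; apply: le_trans; rewrite ler_pM2r // ler_nat.
  by rewrite leq_exp2l.
have cov : (((g p * gp q)%:R / 9)%:E <= covering_number d E
            <= (a (k + 2)%N * b (l - k)%N)%:R%:E)%E.
  apply/andP; split.
    apply: cov_ge => //; first exact: pow_le nk1.
    by apply: pow_le ml1 => //; rewrite -(subnKC le_kl) leq_add.
  apply: cov_le => //.
  by rewrite (_ : k + 2 + (l - k) = l + 2)%N // addnAC subnKC.
have lo_gt0 : 0 < (g p * gp q)%:R / 9 :> R by rewrite divr_gt0 // ltr0n muln_gt0 gp_gt0.
have vL : v * L = hp * (L / ln m%:R) + (h - hp) * (L / ln n%:R).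
  by rewrite /v; field; rewrite !gt_eqF.
have eL : e * (L / ln m%:R) = eps / 2 * L by rewrite /e; field; rewrite gt_eqF.
have /andP[lower upper] := box_ratio_bounds d01 lo_gt0 cov.
move: near_k near_l1 near_l2; rewrite !ler_norml => /andP[k1 k2] /andP[l1 l2] /andP[l3 l4].
apply/andP; split.
  apply: le_trans lower; rewrite lee_fin ler_pdivlMr // -/L.
  rewrite ln_div ?posrE // ?ltr0n ?muln_gt0 ?gp_gt0 // natrM lnM ?posrE ?ltr0n //.
  rewrite lkE in gq_le.
  rewrite mulrBl vL; rewrite /c2 in c2L.
  clear - gp_le gq_le k1 l3 eL c2L; lra.
apply: le_trans upper _; rewrite lee_fin ler_pdivrMr // -/L.
rewrite natrM lnM ?posrE ?ltr0n //.
have := aK (k + 2)%N; have := bK (l - k)%N; rewrite lkE natrD => hb ha.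
rewrite mulrDl vL; rewrite /c1 in c1L.
clear - ha hb k2 l2 eL c1L; lra.
Qed.

Theorem theorem1p4 (R : realType) (m n : nat) (hm : (2 <= m)%N) (hmn : (m < n)%N)
  (C : set (seq ('I_m * 'I_n))) (Sigma : set (nat -> 'I_m * 'I_n))
  (hSigma : Sigma = coded_subshift C)
  (hG : limn_esup (log_rate R (fun k => #|generated_words Sigma C k|))
        = entropy R Sigma)
  (hpiG : limn_esup (log_rate R (fun k =>
            #|generated_words (proj_shift Sigma) (proj_words C) k|))
          = entropy R (proj_shift Sigma)) :
  has_box_dim (@coding_map R m n @` Sigma)
    (entropy R (proj_shift Sigma) / (ln (m%:R : R))%:E
     + (entropy R Sigma - entropy R (proj_shift Sigma)) / (ln (n%:R : R))%:E)%E.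
Proof.
have n_ge2 : (2 <= n)%N by apply: leq_trans hm (ltnW hmn).
have m_gt0 : (0 < m)%N by apply: leq_trans hm.
have n_gt0 : (0 < n)%N by apply: leq_trans n_ge2.
have lm_gt0 : 0 < ln m%:R :> R by rewrite ln_gt0 // ltr1n.
have lnn_gt0 : 0 < ln n%:R :> R by rewrite ln_gt0 // ltr1n.
have [S0|/set0P Sigma0] := eqVneq Sigma set0.
  (* With the convention -oo - -oo = -oo, the claimed value is -oo. *)
  rewrite S0 /proj_shift !image_set0 !entropy_set0 !inver !gt_eqF //.
  rewrite [(-oo - -oo)%E]/= !mulNyr !gtr0_sg ?invr_gt0 // !mul1e.
  exact: has_box_dim_set0.
have baseS : coded_base C `<=` Sigma.
  rewrite hSigma.
  exact: (@subset_closure {ptws nat -> discrete_topology ('I_m * 'I_n)%type}).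
have [c0 Cc0 c0_gt0] : exists2 c, C c & (0 < size c)%N.
  have [base0|/set0P[x /coded_base_generator]] := eqVneq (coded_base C) set0; last exact.
  by case: Sigma0 => x; rewrite hSigma /coded_subshift base0 closure0.
have genS : generated C `<=` language Sigma.
  move=> w /(coded_base_extends Cc0 c0_gt0)[x /baseS Sx <-].
  exact: (mkseq_language 0).
have genP : generated (proj_words C) `<=` language (proj_shift Sigma).
  move=> _ /generated_proj[w /genS[x Sx [k eq_w]] ->].
  exists (proj_seq x); first by exists x.
  by exists k; rewrite size_map eq_w /mkseq size_map size_iota -map_comp.
have proj0 : proj_shift Sigma !=set0.
  by have [x Sx] := Sigma0; exists (proj_seq x), x.
have [h hE h_le] := entropy_growth R Sigma0.
have [hp hpE hp_le] := entropy_growth R proj0.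
rewrite hE in hG; rewrite hpE in hpiG.
rewrite hE hpE !inver !gt_eqF // -EFinB -!EFinM -EFinD.
apply: (has_box_dim_of_growth hm hmn h_le hp_le) => [k|k|eps|eps|d p q|d p q _].
- exact: words_gt0.
- exact: words_gt0.
- apply: supermultiplicative_growth hG; first exact: generated_words0.
  by move=> k l; exact: card_generated_words_add.
- apply: supermultiplicative_growth hpiG; first exact: generated_words0.
  by move=> k l; exact: card_generated_words_add.
- exact: covering_number_le_words.
- exact: le_covering_number_generated Cc0 c0_gt0 baseS.
Qed.
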